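(* Let $\delta\ge3$ be an integer such that $\delta=q-1$ for some prime power $q$. Then there exist a constant $C$ (depending only on $\delta$) and infinitely many connected $C_4$-free graphs $G$ of minimum degree at least $\delta$ such that, writing $n$ for the order of $G$, \[\left|\rho(G)-\frac52\cdot\frac{n}{\delta^2+3\delta+2}\right|\le C\quad\text{and}\quad\left|\pi(G)-\frac54\cdot\frac{n}{\delta^2+3\delta+2}\right|\le C.\]
   Context: $C_4$-free means containing no 4-cycle as a subgraph. For a connected graph $G$ of order $n\ge2$ and vertex $v$, $\overline{\sigma}(v)=\frac{1}{n-1}\sum_w d(v,w)$; the remoteness is $\rho(G)=\max_v\overline{\sigma}(v)$ and the proximity is $\pi(G)=\min_v\overline{\sigma}(v)$. *)

(* Defs.v *)
From mathcomp Require Import all_boot all_order all_algebra.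
From mathcomp Require Import reals.

Set Implicit Arguments.
Unset Strict Implicit.
Unset Printing Implicit Defensive.

Import Order.TTheory GRing.Theory Num.Theory.
Local Open Scope ring_scope.

Record sgraph := SGraph {
  vertex :> finType;
  adj : rel vertex;
  adj_sym : symmetric adj;
  adj_irrefl : irreflexive adj }.

Definition graph_iso (G H : sgraph) : Prop :=
  exists2 f : G -> H, bijective f & forall x y : G, adj (f x) (f y) = adj x y.

(* The graph with no vertices is not connected. *)
Definition connected_graph (G : sgraph) : Prop :=
  (0 < #|G|)%N /\ forall x y : G, connect (@adj G) x y.

(* [ucycleb] asks for a closed walk without repeated vertices; for length 4
   this is exactly a (not necessarily induced) copy of C_4. *)
Definition C4_free (G : sgraph) : Prop :=
  forall c : 4.-tuple G, ~~ ucycleb (@adj G) c.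

Definition deg (G : sgraph) (v : G) : nat := #|[set w | adj v w]|.

(* Degrees are smaller than #|G|, so #|G| is neutral for this minimum. *)
Definition min_deg (G : sgraph) : nat := \big[minn/#|G|]_(v : G) deg v.

Definition walk_of_length (G : sgraph) (v w : G) (k : nat) : bool :=
  [exists p : k.-tuple G, path (@adj G) v p && (last v p == w)].

(* The least k < #|G| for which a walk of length k exists, the candidates
   being listed in increasing order.  A shortest walk has fewer than #|G|
   edges; the value is #|G| if w is not reachable from v. *)
Definition dist (G : sgraph) (v w : G) : nat :=
  find (walk_of_length v w) (iota 0 #|G|).

Definition avg_dist (R : realType) (G : sgraph) (v : G) : R :=
  (\sum_(w : G) dist v w)%:R / (#|G|.-1)%:R.

(* Average distances lie between 0 and #|G|, so the base values of the two
   iterated operations below never affect a nonempty maximum or minimum. *)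
Definition remoteness (R : realType) (G : sgraph) : R :=
  \big[Num.max/0]_(v : G) avg_dist R v.

Definition proximity (R : realType) (G : sgraph) : R :=
  \big[Num.min/#|G|%:R]_(v : G) avg_dist R v.

Definition prime_power (q : nat) : Prop :=
  exists p k : nat, [/\ prime p, (0 < k)%N & q = (p ^ k)%N].

(* Main.v *)
(** Deleting an absolute point from the polarity graph of the projective plane
over [F_q] leaves the [q^2 + q] vertices [F_q^2 + F_q], with [(x, y)] adjacent
to [(x', y')] when [y + y' = x x'], and to the slope [x].  Deleting moreover the
edges with [x = x'] or [x + x' = 1] keeps all degrees at least [q - 1] and puts
the slopes [0] and [1] at distance exactly 4.  In a chain of [2m + 1] such
blocks, slope [1] of each being joined to slope [0] of the next by a bridge,
the distance between vertices of blocks [i] and [j] is [5 |i - j|] up to a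
bounded error, so average distances are those of a long path. *)
Require Import Defs.
From mathcomp Require Import all_boot all_order all_algebra.
From mathcomp Require Import finfield.
From mathcomp Require Import reals.
From mathcomp Require Import zify ring lra.

Set Implicit Arguments.
Unset Strict Implicit.
Unset Printing Implicit Defensive.

Import Order.TTheory GRing.Theory Num.Theory.
Local Open Scope ring_scope.

(** * Walks of bounded length and distance bounds in arbitrary graphs *)

Definition within (G : sgraph) (k : nat) (x y : G) : Prop :=
  exists p : seq G, [/\ path (@adj G) x p, last x p = y & (size p <= k)%N].

Lemma within0 (G : sgraph) (x : G) : within 0 x x.
Proof. by exists [::]. Qed.

Lemma within1 (G : sgraph) (x y : G) : adj x y -> within 1 x y.
Proof. by move=> xy; exists [:: y]; rewrite /= xy. Qed.

Lemma within_le (G : sgraph) (k l : nat) (x y : G) :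
  (k <= l)%N -> within k x y -> within l x y.
Proof.
by move=> kl [p [xp lp sp]]; exists p; split=> //; apply: leq_trans kl.
Qed.

Lemma within_trans (G : sgraph) (k l : nat) (y x z : G) :
  within k x y -> within l y z -> within (k + l) x z.
Proof.
move=> [p [xp lp sp]] [r [yr lr sr]]; exists (p ++ r); split.
- by rewrite cat_path xp lp.
- by rewrite last_cat lp.
- by rewrite size_cat leq_add.
Qed.

Lemma within_sym (G : sgraph) (k : nat) (x y : G) :
  within k x y -> within k y x.
Proof.
move=> [p [xp <- sp]]; exists (rev (belast x p)); split.
- rewrite rev_path; move: xp; congr is_true; apply: eq_path => a b.
  exact: adj_sym.
- by case: p {xp sp} => //= a p; rewrite rev_cons last_rcons.
- by rewrite size_rev size_belast.
Qed.

Lemma within_connect (G : sgraph) (k : nat) (x y : G) :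
  within k x y -> connect (@adj G) x y.
Proof. by move=> [p [xp <- _]]; apply/connectP; exists p. Qed.

Lemma within_dist (G : sgraph) (k : nat) (x y : G) :
  within k x y -> (dist x y <= k)%N.
Proof.
move=> [p [xp lp sp]]; apply: leq_trans sp; rewrite /dist leqNgt.
set s := iota 0 _; apply/negP => lt_find.
have szs : (find (walk_of_length x y) s <= #|G|)%N.
  by rewrite -[leqRHS](size_iota 0) find_size.
(* The candidates are [0, 1, 2, ...], so the one at index [size p] is [size p] itself, and [p] is a
   walk of that length. *)
have := before_find 0%N lt_find; rewrite nth_iota ?(leq_trans lt_find) //.
rewrite add0n => /negbT/negP; apply; rewrite /walk_of_length.
apply/existsP; exists (in_tuple p).
by rewrite xp lp eqxx.
Qed.

Lemma path_lipschitz (G : sgraph) (f : G -> nat) (x : G) (p : seq G) :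
  (forall a b : G, adj a b -> (f b <= (f a).+1)%N) ->
  path (@adj G) x p -> (f (last x p) <= f x + size p)%N.
Proof.
move=> fL; elim: p x => [|a p IH] x /=; first by rewrite addn0.
by move=> /andP[/fL xa /IH]; lia.
Qed.

(** Source of the lower bounds on distances: along a walk [f] gains at most 1 per edge. The bound on
    [f y] covers the default value [#|G|] that [dist] takes when no walk is found. *)
Lemma dist_lipschitz (G : sgraph) (f : G -> nat) (x y : G) :
  (forall a b : G, adj a b -> (f b <= (f a).+1)%N) ->
  (f y <= #|G|)%N -> (f y <= f x + dist x y)%N.
Proof.
move=> fL fy.
have [|nowalk] := boolP (has (walk_of_length x y) (iota 0 #|G|)); last first.
  by rewrite /dist hasNfind // size_iota; lia.
move=> walk; have := nth_find 0%N walk.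
rewrite nth_iota -/(dist x y) ?add0n; last first.
  by move: walk; rewrite has_find size_iota.
rewrite /walk_of_length => /existsP[p /andP[xp /eqP last_p]].
by have := path_lipschitz fL xp; rewrite size_tuple last_p.
Qed.

(** In a 4-cycle [x b y d] the opposite vertices [x] and [y] have the distinct common neighbours [b]
    and [d]. *)
Lemma C4_free_common_neighbour (G : sgraph) :
  (forall x y b d : G, x != y ->
     adj x b -> adj x d -> adj y b -> adj y d -> b = d) ->
  C4_free G.
Proof.
move=> uniq_nb [s sz]; apply/negP => /=.
case: s sz => [|x [|b [|y [|d [|? ?]]]]] //= _.
rewrite /ucycleb /= !inE !negb_or !andbT.
case/andP=> /and4P[xb b_y yd dx] /and3P[/and3P[_ xy _] /andP[_ bd] _].
by case/eqP: bd; apply: (uniq_nb x y); rewrite // adj_sym.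
Qed.

Lemma leq_min_deg (G : sgraph) (d : nat) :
  (d <= #|G|)%N -> (forall v : G, d <= deg v)%N -> (d <= min_deg G)%N.
Proof.
move=> dG ddeg; rewrite /min_deg.
by elim/big_ind: _ => // a b da db; rewrite leq_min da db.
Qed.

Lemma graph_iso_card (G H : sgraph) : graph_iso G H -> #|G| = #|H|.
Proof. by case=> f bij_f _; apply: bij_eq_card bij_f. Qed.

(** * Sums of distances on a path of integers *)

Definition absdiff (i j : nat) : nat := (i - j + (j - i))%N.

(** The [a] positions left of [a] and the [c] positions right of it contribute one triangular number
    each. *)
Lemma sum_absdiff (a c : nat) :
  (2 * \sum_(j < a + c.+1) absdiff a j = a * a.+1 + c * c.+1)%N.
Proof.
elim: c => [|c IH].
  rewrite addn1; elim: a => [|a IH]; first by rewrite big_ord_recr big_ord0.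
  rewrite big_ord_recl /= (eq_bigr (fun j : 'I_a.+1 => absdiff a j)) //.
  by rewrite mulnDr IH /absdiff; lia.
by rewrite addnS big_ord_recr /= mulnDr IH /absdiff; lia.
Qed.

Lemma sum_absdiff_bounds (m i : nat) : (i < m.*2.+1)%N ->
  (m * m.+1 <= \sum_(j < m.*2.+1) absdiff i j <= m * m.*2.+1)%N.
Proof.
move=> im; have := sum_absdiff i (m.*2 - i).
have -> : (i + (m.*2 - i).+1 = m.*2.+1)%N by lia.
set S := (\sum_(j < _) _)%N; set c := (m.*2 - i)%N => eS.
have ic : (i + c = m.*2)%N by rewrite /c; lia.
(* With [i + c = 2m] fixed, [i * i + c * c] is least at [i = c] and at most [(i + c)] squared, which
   it reaches at the two ends. *)
have : (2 * (i * c) <= i * i + c * c)%N by rewrite !mulnn nat_Cauchy.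
have : ((i + c) * (i + c) = 4 * (m * m))%N by rewrite ic; lia.
by move=> *; apply/andP; split; nia.
Qed.

(** * The blocks and the chain: absence of 4-cycles and degrees *)

Section Chain.

Variable F : finFieldType.

Local Notation block := (F * F + F)%type.

Definition block_adj (z z' : block) : bool :=
  match z, z' with
  | inl (x, y), inl (x', y') =>
      [&& x != x', x + x' != 1 & y + y' == x * x']
  | inl (x, _), inr m | inr m, inl (x, _) => x == m
  | inr _, inr _ => false
  end.

Lemma block_adj_sym : symmetric block_adj.
Proof.
move=> [[x y]|m] [[x' y']|m'] //=.
by rewrite eq_sym (addrC x) (addrC y) mulrC.
Qed.

Lemma block_adj_irrefl : irreflexive block_adj.
Proof. by case=> [[x y]|m] //=; rewrite eqxx. Qed.

(** For affine [x] and [y] with affine common neighbours, the four adjacency equations combine to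
    [(x1 - y1) * (b1 - d1) = 0]. A slope fixes the first coordinate of its neighbours, and an affine
    point has only one slope as neighbour. *)
Lemma block_common_neighbour (x y b d : block) : x != y ->
  block_adj x b -> block_adj x d -> block_adj y b -> block_adj y d -> b = d.
Proof.
(* A neighbour of an affine point is determined by its first coordinate. *)
have eq_fst (x1 x2 b1 b2 d1 d2 : F) : x2 + b2 = x1 * b1 ->
    x2 + d2 = x1 * d1 -> b1 = d1 -> inl (b1, b2) = inl (d1, d2) :> block.
  move=> eb ed bd; rewrite -bd -eb in ed.
  by rewrite -bd; congr (inl (_, _)); apply: (addrI x2); rewrite ed.
case: x => [[x1 x2]|x]; case: y => [[y1 y2]|y];
  case: b => [[b1 b2]|b]; case: d => [[d1 d2]|d] //= /eqP neq.
- move=> /and3P[_ _ /eqP xb] /and3P[_ _ /eqP xd].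
  move=> /and3P[_ _ /eqP yb] /and3P[_ _ /eqP yd].
  have : (x1 - y1) * (b1 - d1) = 0.
    by rewrite mulrBr !mulrBl -xb -xd -yb -yd; ring.
  move/eqP; rewrite mulf_eq0 !subr_eq0 => /orP[/eqP x1y1|/eqP].
    by case: neq; apply: (eq_fst b1 b2) => //; rewrite addrC mulrC.
  exact: eq_fst xb xd.
- move=> /and3P[_ _ /eqP xb] /eqP xd /and3P[_ _ /eqP yb] /eqP yd.
  by case: neq; apply: (eq_fst b1 b2); rewrite 1?addrC 1?mulrC // yd.
- move=> /eqP xb /and3P[_ _ /eqP xd] /eqP yb /and3P[_ _ /eqP yd].
  by case: neq; apply: (eq_fst d1 d2); rewrite 1?addrC 1?mulrC // yb.
- by move=> /eqP -> /eqP ->.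
- move=> /and3P[_ _ /eqP xb] /and3P[_ _ /eqP xd] /eqP yb /eqP yd.
  by apply: eq_fst xb xd _; rewrite yd.
- move=> /eqP xb /eqP xd /and3P[_ _ /eqP yb] /and3P[_ _ /eqP yd].
  by apply: eq_fst yb yd _; rewrite xd.
- by move=> /eqP xb _ /eqP yb; case: neq; rewrite -xb yb.
Qed.

Definition link (k : nat) (u v : 'I_k * block) : bool :=
  [&& v.1 == u.1.+1 :> nat, u.2 == inr 1 & v.2 == inr 0].

Definition chain_adj (k : nat) (u v : 'I_k * block) : bool :=
  [|| (u.1 == v.1) && block_adj u.2 v.2, link u v | link v u].

Lemma chain_adj_sym (k : nat) : symmetric (@chain_adj k).
Proof.
by move=> u v; rewrite /chain_adj eq_sym block_adj_sym [link v u || _]orbC.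
Qed.

Lemma chain_adj_irrefl (k : nat) : irreflexive (@chain_adj k).
Proof.
move=> u; rewrite /chain_adj /link block_adj_irrefl andbF /=.
by rewrite ltn_eqF.
Qed.

Definition chain (k : nat) : sgraph :=
  SGraph (@chain_adj_sym k) (@chain_adj_irrefl k).

Lemma card_chain (k : nat) : #|chain k| = (k * (#|F| ^ 2 + #|F|))%N.
Proof. by rewrite card_prod card_sum card_prod card_ord -mulnn. Qed.

(* The case analysis closes because a link is a bridge whose end vertices,
   being slopes, have only affine points as neighbours inside their blocks. *)
Lemma chain_C4_free (k : nat) : C4_free (chain k).
Proof.
apply: C4_free_common_neighbour => -[i x] [j y] [l b] [n d] neq.
rewrite /adj /= /chain_adj /link /=.
case/or3P=> [/andP[/eqP ? xb]|/and3P[/eqP ? /eqP ? /eqP ?]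
            |/and3P[/eqP ? /eqP ? /eqP ?]];
  case/or3P=> [/andP[/eqP ? xd]|/and3P[/eqP ? /eqP ? /eqP ?]
              |/and3P[/eqP ? /eqP ? /eqP ?]];
  case/or3P=> [/andP[/eqP ? yb]|/and3P[/eqP ? /eqP ? /eqP ?]
              |/and3P[/eqP ? /eqP ? /eqP ?]];
  case/or3P=> [/andP[/eqP ? yd]|/and3P[/eqP ? /eqP ? /eqP ?]
              |/and3P[/eqP ? /eqP ? /eqP ?]];
  subst => //; try by (exfalso; lia).
all: try by (congr (_, _); apply: val_inj => /=; lia).
all: try by rewrite eqxx in neq.
- congr (_, _); apply: block_common_neighbour xb xd yb yd.
  by apply: contra neq => /eqP ->.
- by case/eqP: neq; congr (_, _); apply: val_inj => /=; lia.
- by case/eqP: neq; congr (_, _); apply: val_inj => /=; lia.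
Qed.

Lemma leq_deg_chain (k : nat) (v : chain k) : (#|F| - 1 <= deg v)%N.
Proof.
case: v => i [[x y]|m]; rewrite /deg.
(* One neighbour for each [t != 1 - x]. The deleted edge at [t = x] is made up for by the slope [x],
   so only [t = 1 - x] is lost. *)
- pose g (t : F) : chain k :=
    (i, if t == x then inr x else inl (t, x * t - y)).
  have g_inj : injective g.
    move=> s t; rewrite /g; case: eqP => [->|_]; case: eqP => [->|_] //.
    by case.
  have -> : (#|F| - 1)%N = #|[set~ (1 - x)]| by rewrite cardsC1 subn1.
  rewrite -(card_imset _ g_inj); apply: subset_leq_card.
  apply/subsetP => w /imsetP[t]; rewrite !inE => tx ->.
  rewrite /adj /= /chain_adj /g /= eqxx /=.
  have [_|xt] := eqVneq t x; first by rewrite eqxx.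
  have -> : x + t != 1.
    by apply: contra tx => /eqP <-; rewrite addrAC subrr add0r.
  by rewrite eq_sym xt [y + _]addrC subrK eqxx.
- pose g (t : F) : chain k := (i, inl (m, t)).
  have g_inj : injective g by move=> s t [].
  rewrite (leq_trans (leq_subr _ _)) // -(card_imset _ g_inj).
  apply: subset_leq_card; apply/subsetP => w /imsetP[t _ ->].
  by rewrite inE /adj /= /chain_adj /= !eqxx.
Qed.

(** * Distances within a block and along the chain *)

Hypothesis F_ge4 : (4 <= #|F|)%N.

Lemma exists_neq01 : exists2 s : F, s != 0 & s != 1.
Proof.
pose B : {set F} := [set 0; 1].
have : (0 < #|~: B|)%N.
  have := cardsC B; rewrite cards2 eq_sym oner_eq0 => cB.
  by move: F_ge4; rewrite -cB; case: #|_|.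
by case/card_gt0P => s; rewrite /B !inE negb_or => /andP[]; exists s.
Qed.

Lemma within_slope (k : nat) (i : 'I_k) (m : F) :
  m != 1 -> within (G := chain k) 3 (i, inr (0 : F)) (i, inr m).
Proof.
move=> m1; have [->|m0] := eqVneq m 0; first by apply: within_le (within0 _).
have adj1 : @adj (chain k) (i, inr (0 : F)) (i, inl (0 : F, 0 : F)).
  by rewrite /adj /= /chain_adj /= !eqxx.
have adj2 : @adj (chain k) (i, inl (0 : F, 0 : F)) (i, inl (m, 0)).
  by rewrite /adj /= /chain_adj /= eqxx eq_sym m0 add0r m1 addr0 mul0r eqxx.
have adj3 : @adj (chain k) (i, inl (m, 0)) (i, inr m).
  by rewrite /adj /= /chain_adj /= !eqxx.
exact: within_trans (within_trans (within1 adj1) (within1 adj2))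
  (within1 adj3).
Qed.

(** Edges between first coordinates 0 and 1 are deleted, as [0 + 1 = 1]; the walk makes a detour
    through a third first coordinate [s]. *)
Lemma within_slope01 (k : nat) (i : 'I_k) :
  within (G := chain k) 4 (i, inr (0 : F)) (i, inr 1).
Proof.
have [s s0 s1] := exists_neq01.
have adj1 : @adj (chain k) (i, inr (0 : F)) (i, inl (0 : F, 0 : F)).
  by rewrite /adj /= /chain_adj /= !eqxx.
have adj2 : @adj (chain k) (i, inl (0 : F, 0 : F)) (i, inl (s, 0)).
  by rewrite /adj /= /chain_adj /= eqxx eq_sym s0 add0r s1 addr0 mul0r eqxx.
have adj3 : @adj (chain k) (i, inl (s, 0)) (i, inl (1, s)).
  rewrite /adj /= /chain_adj /= eqxx s1 add0r mulr1 eqxx andbT.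
  by rewrite -subr_eq0 addrK s0.
have adj4 : @adj (chain k) (i, inl (1, s)) (i, inr 1).
  by rewrite /adj /= /chain_adj /= !eqxx.
exact: within_trans (within_trans (within1 adj1) (within1 adj2))
  (within_trans (within1 adj3) (within1 adj4)).
Qed.

Lemma within_block (k : nat) (i : 'I_k) (z : block) :
  within (G := chain k) 5 (i, inr (0 : F)) (i, z).
Proof.
have slope m : within (G := chain k) 4 (i, inr (0 : F)) (i, inr m).
  have [->|/within_slope m1] := eqVneq m 1; first exact: within_slope01.
  exact: within_le (m1 _ _).
case: z => [[x y]|m]; last by apply: within_le (slope m).
apply: (@within_trans (chain k) 4 1 (i, inr x)); first exact: slope.
by apply: within1; rewrite /adj /= /chain_adj /= !eqxx.
Qed.

Lemma within_blocks (k d : nat) (i j : 'I_k) : j = (i + d)%N :> nat ->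
  within (G := chain k) (5 * d) (i, inr (0 : F)) (j, inr (0 : F)).
Proof.
elim: d j => [|d IH] j ij.
  have -> : j = i by apply: val_inj; rewrite /= ij addn0.
  exact: within0.
have lt_k : (i + d < k)%N by have := ltn_ord j; lia.
(* Each block costs 5: four edges from slope 0 to slope 1, then the bridge. *)
rewrite mulnS addnC; apply: within_trans (IH (Ordinal lt_k) (erefl _)) _.
apply: (@within_trans (chain k) 4 1 (Ordinal lt_k, inr 1)).
  exact: within_slope01.
apply: within1; rewrite /adj /= /chain_adj /link /= ij addnS !eqxx.
by rewrite orbT.
Qed.

(** The walk goes from [u] to slope 0 of its block, then to slope 0 of the block of [v], then to
    [v]; both end pieces have length at most 5. *)
Lemma within_chain (k : nat) (u v : chain k) :
  within (5 * absdiff u.1 v.1 + 10) u v.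
Proof.
have mid : within (G := chain k) (5 * absdiff u.1 v.1)
    (u.1, inr (0 : F)) (v.1, inr (0 : F)).
  have [uv|/ltnW vu] := leqP u.1 v.1.
  - by apply: within_blocks; rewrite /absdiff; lia.
  - by apply/within_sym/within_blocks; rewrite /absdiff; lia.
case: u v mid => i y [j z] /= mid.
have -> : (5 * absdiff i j + 10 = 5 + (5 * absdiff i j + 5))%N by lia.
apply: within_trans (within_trans mid (within_block _ _)).
exact/within_sym/within_block.
Qed.

Lemma chain_connected (k : nat) : (0 < k)%N -> connected_graph (chain k).
Proof.
move=> k0; split; first by rewrite card_chain; nia.
by move=> u v; apply: within_connect (within_chain u v).
Qed.

(* A 1-Lipschitz function with values 0 and 4 at the slopes 0 and 1 certifies
   that these are at distance 4. *)
Definition block_level (z : block) : nat :=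
  match z with
  | inl (x, _) => if x == 0 then 1%N else if x == 1 then 3%N else 2%N
  | inr m => if m == 0 then 0%N else if m == 1 then 4%N else 2%N
  end.

(** The factor 5 makes levels consecutive across a bridge: [5 * i + 4] at slope 1, [5 * i.+1] at the
    next slope 0. *)
Definition level (k : nat) (u : chain k) : nat :=
  (5 * u.1 + block_level u.2)%N.

Lemma block_level_le4 (z : block) : (block_level z <= 4)%N.
Proof. by case: z => [[x y]|m] /=; do 2?case: ifP. Qed.

Lemma block_level_lipschitz (z z' : block) :
  block_adj z z' -> (block_level z' <= (block_level z).+1)%N.
Proof.
case: z z' => [[x y]|m] [[x' y']|m'] //=; last first.
- by move/eqP=> ->; do 2?case: ifP.
- by move/eqP=> ->; do 2?case: ifP.
- case/and3P=> _ + _.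
  (* The only possible rise by 2 is from first coordinate 0 to 1, where the edges are deleted. *)
  have [->|_] := eqVneq x 0; last by do 4?case: ifP.
  have [->|_] := eqVneq x' 0; first by [].
  by have [->|//] := eqVneq x' 1; rewrite add0r eqxx.
Qed.

Lemma level_lipschitz (k : nat) (u v : chain k) :
  adj u v -> (level v <= (level u).+1)%N.
Proof.
case: u v => i y [j z]; rewrite /adj /= /chain_adj /link /level /=.
case/or3P.
- by case/andP=> /eqP -> /block_level_lipschitz; lia.
- by case/and3P=> /eqP -> /eqP -> /eqP ->; rewrite /= !eqxx oner_eq0; lia.
- by case/and3P=> /eqP -> /eqP -> /eqP ->; rewrite /= !eqxx oner_eq0; lia.
Qed.

Lemma dist_chain_ge (k : nat) (u v : chain k) :
  (5 * absdiff u.1 v.1 <= dist u v + 4)%N.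
Proof.
have lev w : (level (w : chain k) <= #|chain k|)%N.
  rewrite card_chain /level; have := ltn_ord w.1.
  by have := block_level_le4 w.2; nia.
have uv := dist_lipschitz u (@level_lipschitz k) (lev v).
(* The level itself handles the case where [v] lies higher than [u]; its complement, also
   1-Lipschitz, handles the opposite case. *)
have vu := @dist_lipschitz _ (fun w => #|chain k| - level w)%N u v.
have {}vu : (#|chain k| - level v <= #|chain k| - level u + dist u v)%N.
  apply: vu => [a b|]; last exact: leq_subr.
  by rewrite adj_sym => /level_lipschitz; lia.
move: uv vu (lev u) (lev v) (block_level_le4 u.2) (block_level_le4 v.2).
rewrite /level /absdiff; lia.
Qed.

Lemma dist_chain_le (k : nat) (u v : chain k) :
  (dist u v <= 5 * absdiff u.1 v.1 + 10)%N.
Proof. exact/within_dist/within_chain. Qed.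

(** * Distance sums in the chain *)

Lemma sum_chain (k : nat) (f : nat -> nat) :
  (\sum_(w : chain k) f w.1 = (#|F| ^ 2 + #|F|) * \sum_(j < k) f j)%N.
Proof.
rewrite -(pair_bigA _ (fun (j : 'I_k) (_ : block) => f j)) /=.
rewrite big_distrr /=; apply: eq_bigr => j _.
by rewrite sum_nat_const card_sum card_prod -mulnn.
Qed.

Lemma sum_dist_chain (k : nat) (u : chain k) :
  (5 * (#|F| ^ 2 + #|F|) * \sum_(j < k) absdiff u.1 j
     <= \sum_(w : chain k) dist u w + 4 * #|chain k|)%N /\
  (\sum_(w : chain k) dist u w
     <= 5 * (#|F| ^ 2 + #|F|) * \sum_(j < k) absdiff u.1 j
        + 10 * #|chain k|)%N.
Proof.
rewrite -mulnA -sum_chain big_distrr /=; split.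
- have -> : (4 * #|chain k| = \sum_(w : chain k) 4)%N.
    by rewrite sum_nat_const mulnC.
  by rewrite -big_split /=; apply: leq_sum => w _; apply: dist_chain_ge.
- have -> : (10 * #|chain k| = \sum_(w : chain k) 10)%N.
    by rewrite sum_nat_const mulnC.
  by rewrite -big_split /=; apply: leq_sum => w _; apply: dist_chain_le.
Qed.

End Chain.

(** * Remoteness and proximity of a chain of odd length *)

Section ChainAverages.

Variables (R : realType) (F : finFieldType) (m : nat).
Hypothesis F_ge4 : (4 <= #|F|)%N.

Local Notation G := (chain F m.*2.+1).
Local Notation k := (m.*2.+1%:R : R).
Local Notation b := ((#|F| ^ 2 + #|F|)%N%:R : R).
Local Notation S u := ((\sum_(j < m.*2.+1) absdiff u.1 j)%N%:R : R).

Lemma block_size_ge20 : 20 <= b.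
Proof. by rewrite ler_nat -mulnn; nia. Qed.

Lemma chain_length_eq : k = 2 * m%:R + 1.
Proof. by rewrite -natr1 -mul2n natrM. Qed.

Lemma avg_dist_chain (u : G) :
  5 * b * S u - 4 * (k * b) <= avg_dist R u * (k * b - 1)
    <= 5 * b * S u + 10 * (k * b).
Proof.
have cG : #|G|%:R = k * b :> R by rewrite card_chain natrM.
have cG_gt1 : (1 < #|G|)%N by rewrite card_chain -mulnn; nia.
rewrite /avg_dist -cG -subn1 natrB 1?ltnW // divfK; last first.
  by rewrite subr_eq0 (eqr_nat R _ 1) gtn_eqF.
have [lo hi] := sum_dist_chain F_ge4 u.
set B := (#|F| ^ 2 + #|F|)%N in lo hi *.
rewrite -(ler_nat R) natrD !natrM in lo.
rewrite -(ler_nat R) natrD !natrM in hi.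
by apply/andP; split; [rewrite lerBlDr|].
Qed.

Lemma sum_absdiff_chain (u : G) :
  m%:R * (m%:R + 1) <= S u <= m%:R * (2 * m%:R + 1).
Proof.
have /andP[lo hi] := sum_absdiff_bounds (ltn_ord u.1).
by rewrite -chain_length_eq natr1 -!natrM !ler_nat lo hi.
Qed.

Lemma chain_pred_gt0 : 0 < k * b - 1.
Proof.
have := block_size_ge20; have := ler0n R m; rewrite chain_length_eq; nra.
Qed.

Lemma avg_dist_chain_le (u : G) (c : R) :
  S u <= c -> avg_dist R u <= (5 * b * c + 10 * (k * b)) / (k * b - 1).
Proof.
move=> Sc; have /andP[_ hi] := avg_dist_chain u.
rewrite ler_pdivlMr ?chain_pred_gt0 //; apply: le_trans hi _.
by have := block_size_ge20; nra.
Qed.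

Lemma avg_dist_chain_ge (u : G) (c : R) :
  c <= S u -> (5 * b * c - 4 * (k * b)) / (k * b - 1) <= avg_dist R u.
Proof.
move=> Sc; have /andP[lo _] := avg_dist_chain u.
rewrite ler_pdivrMr ?chain_pred_gt0 //; apply: le_trans lo.
by have := block_size_ge20; nra.
Qed.

(** The largest value of [S u] is [m * k = (k ^ 2 - k) / 2], so the main term [5 * S u / k] is
    [5 / 2 * (k - 1)]. *)
Lemma remoteness_chain : `|remoteness R G - 5 / 2 * k| <= 30.
Proof.
have b20 := block_size_ge20; have m0 := ler0n R m.
(* Once denominators are cleared, the cubic terms cancel and the inequalities are linear in [m], [b]
   and [b * m]. *)
have bm : 20 * m%:R <= b * m%:R by rewrite ler_wpM2r.
rewrite ler_distl; apply/andP; split.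
  (* A vertex of an end block attains the largest [S u]. *)
  pose u : G := (ord0, inr 0); apply: (bigmax_sup u) => //.
  have Su : m%:R * (2 * m%:R + 1) <= S u.
    have := sum_absdiff 0 m.*2; rewrite mul0n add0n => Su.
    rewrite -chain_length_eq -natrM ler_nat -(leq_pmul2l (ltn0Sn 1)) Su.
    by lia.
  apply: le_trans (avg_dist_chain_ge Su).
  rewrite ler_pdivlMr ?chain_pred_gt0 // chain_length_eq; lra.
apply: bigmax_le => [|u _]; first by rewrite chain_length_eq; lra.
have /andP[_ /avg_dist_chain_le hi] := sum_absdiff_chain u.
apply: le_trans hi _.
rewrite ler_pdivrMr ?chain_pred_gt0 // chain_length_eq; lra.
Qed.

(** The least value of [S u] is [m * (m + 1) = (k ^ 2 - 1) / 4], so the main term [5 * S u / k] is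
    within a constant of [5 / 4 * k]. *)
Lemma proximity_chain : `|proximity R G - 5 / 4 * k| <= 30.
Proof.
have b20 := block_size_ge20; have m0 := ler0n R m.
have bm : 20 * m%:R <= b * m%:R by rewrite ler_wpM2r.
rewrite ler_distl; apply/andP; split.
  apply: le_bigmin => [|u _].
    (* The base value [#|G|] of the minimum must respect the lower bound too. *)
    by rewrite card_chain natrM chain_length_eq; nra.
  have /andP[/avg_dist_chain_ge lo _] := sum_absdiff_chain u.
  apply: le_trans lo.
  rewrite ler_pdivlMr ?chain_pred_gt0 // chain_length_eq; lra.
have lt_m : (m < m.*2.+1)%N by lia.
(* The odd length provides a middle block, whose vertices attain the least [S u]. *)
pose u : G := (Ordinal lt_m, inr 0); apply: (bigmin_inf u) => //.
have Su : S u <= m%:R * (m%:R + 1).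
  have := sum_absdiff m m; rewrite addnS addnn => Su.
  by rewrite natr1 -natrM ler_nat -(leq_pmul2l (ltn0Sn 1)) Su; lia.
apply: le_trans (avg_dist_chain_le Su) _.
rewrite ler_pdivrMr ?chain_pred_gt0 // chain_length_eq; lra.
Qed.

End ChainAverages.

Theorem theorem5p6 (R : realType) (delta : nat) (hdelta : (3 <= delta)%N)
    (hq : exists2 q : nat, prime_power q & delta = (q - 1)%N) :
  exists C : R, exists G : nat -> sgraph,
    (forall i j : nat, i <> j -> ~ graph_iso (G i) (G j)) /\
    (forall i : nat,
      [/\ connected_graph (G i),
          C4_free (G i),
          (delta <= min_deg (G i))%N,
          `| remoteness R (G i)
             - 5 / 2 * (#|G i|%:R / (delta%:R ^+ 2 + 3 * delta%:R + 2)) | <= C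
        & `| proximity R (G i)
             - 5 / 4 * (#|G i|%:R / (delta%:R ^+ 2 + 3 * delta%:R + 2)) | <= C]).

Proof.
have [q [p [e [p_pr e_gt0 ->]]] delta_q] := hq.
have [F _ cF] := PrimePowerField p_pr e_gt0.
have F_ge4 : (4 <= #|F|)%N by rewrite cF; lia.
have deltaF : (delta.+1 = #|F|)%N by rewrite cF; lia.
(* The polynomial is [(delta + 1) * (delta + 2) = q * (q + 1)], the order of a block, so the ratio
   in the theorem is the number of blocks. *)
have sizeE : delta%:R ^+ 2 + 3 * delta%:R + 2 = (#|F| ^ 2 + #|F|)%N%:R :> R.
  by rewrite -deltaF natrD natrX -natr1; ring.
have ratioE i : #|chain F i.*2.+1|%:R / (delta%:R ^+ 2 + 3 * delta%:R + 2)
    = i.*2.+1%:R :> R.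
  rewrite sizeE card_chain natrM mulfK // pnatr_eq0; lia.
exists 30, (fun i => chain F i.*2.+1); split=> [i j ij|i].
  (* Chains of different lengths have different orders. *)
  by move=> /graph_iso_card; rewrite !card_chain -mulnn; nia.
rewrite ratioE; split.
- exact: chain_connected.
- exact: chain_C4_free.
- apply: leq_min_deg => [|v]; first by rewrite card_chain; nia.
  by apply: leq_trans (leq_deg_chain v); lia.
- exact: remoteness_chain.
- exact: proximity_chain.
Qed.
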